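(* Let $n\geq 2$ and let $a^{T}x\leq a_{0}$ define a facet of the linear ordering polytope $P^{n}_{\mathrm{LO}}$. Then the following are facet inequalities of $P^{n}_{\overline{\mathrm{LOD}}}$: (a) $\hat{a}^{T}(x\oplus y\oplus z)\leq a_{0}$, for $\hat{a}=a\oplus 0\oplus 0$ and $\hat{a}=0\oplus a\oplus 0$; (b) $z_{ij}\geq 0$ and $z_{ij}\leq 1$, for all $i,j\in[n]$ such that $i\neq j$; (c) $x_{ij}+y_{ij}-z_{ij}\leq 1$, for all $i,j\in[n]$ such that $i\neq j$.
   Context: $[n]=\{1,\ldots,n\}$; vectors in $\mathbb{R}^{n(n-1)}$ are indexed by ordered pairs $(i,j)$, $i\neq j$, $i,j\in[n]$; $\oplus$ denotes concatenation. The linear ordering polytope $P^n_{\mathrm{LO}}\subseteq\mathbb{R}^{n(n-1)}$ is the convex hull of all $x\in\{0,1\}^{n(n-1)}$ with $x_{ij}+x_{ji}=1$ for all $i<j$ and $x_{ij}+x_{jk}+x_{ki}\leq 2$ for all $i,j,k\in[n]$ with $i<j$, $i<k$, $j\neq k$. $P^{n}_{\overline{\mathrm{LOD}}}\subseteq\mathbb{R}^{3n(n-1)}$ is the convex hull of all $x\oplus y\oplus z\in\{0,1\}^{3n(n-1)}$ such that $x$ and $y$ each satisfy these constraints and $x_{ij}+y_{ij}-z_{ij}\leq 1$ for all $i\neq j$. The dimension of a nonempty polytope is the dimension of its affine hull. If $a^Tw\leq a_0$ is valid for a polytope $P$, the face it defines is $\{w\in P: a^Tw=a_0\}$; a facet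 of $P$ is a face of dimension $\dim P-1$, and an inequality defines a facet (is a facet inequality) if it is valid for $P$ and the face it defines is a facet. *)

(* Defs.v *)
From HB Require Import structures.
From mathcomp Require Import all_boot all_order all_algebra.
From mathcomp Require Import classical_sets reals.

Set Implicit Arguments.
Unset Strict Implicit.
Unset Printing Implicit Defensive.

Import Order.TTheory GRing.Theory Num.Theory.
Local Open Scope classical_set_scope.
Local Open Scope ring_scope.

(* R^I for a finite index type I; R^o is R seen as a vector space over itself,
   which makes [vec R I] a [vectType R]. *)
Notation vec R I := {ffun I -> R^o}.

Definition oplus (R : realType) (I J : finType) (x : vec R I) (y : vec R J)
    : vec R (I + J)%type :=
  [ffun k => match k with inl i => x i | inr j => y j end].

Notation "x ⊕ y" := (oplus x y) (at level 60, right associativity).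

Definition unit_vec (R : realType) (I : finType) (i : I) : vec R I :=
  [ffun k => (k == i)%:R].

Definition dot (R : realType) (I : finType) (a w : vec R I) : R :=
  \sum_(i : I) a i * w i.

Definition is_01 (R : realType) (I : finType) (w : vec R I) : Prop :=
  forall i : I, w i = 0 \/ w i = 1.

Definition convex_hull (R : realType) (V : lmodType R) (S : set V) : set V :=
  [set w | exists (m : nat) (c : 'I_m -> R) (v : 'I_m -> V),
    [/\ forall k, 0 <= c k, forall k, S (v k), \sum_(k < m) c k = 1
      & w = \sum_(k < m) c k *: v k]].

Definition affine_hull (R : realType) (V : lmodType R) (S : set V) : set V :=
  [set w | exists (m : nat) (c : 'I_m -> R) (v : 'I_m -> V),
    [/\ forall k, S (v k), \sum_(k < m) c k = 1
      & w = \sum_(k < m) c k *: v k]].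

(* The affine hull of S is a translate of a d-dimensional linear subspace; in
   particular S is nonempty. *)
Definition has_dim (R : realType) (V : vectType R) (S : set V) (d : nat)
    : Prop :=
  exists (v : V) (U : {vspace V}),
    affine_hull S = [set w | w - v \in U] /\ \dim U = d.

Section Faces.
Variables (R : realType) (I : finType) (P : set (vec R I)).

Definition valid_ineq (a : vec R I) (a0 : R) : Prop :=
  forall w, P w -> dot a w <= a0.

Definition face_of (a : vec R I) (a0 : R) : set (vec R I) :=
  [set w | P w /\ dot a w = a0].

Definition is_face (F : set (vec R I)) : Prop :=
  exists (a : vec R I) (a0 : R), valid_ineq a a0 /\ F = face_of a a0.

(* Facets are required to be nonempty, which only matters for a polytope of
   dimension 0. *)
Definition is_facet (F : set (vec R I)) : Prop :=
  is_face F /\ exists d : nat, has_dim P d.+1 /\ has_dim F d.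

Definition facet_ineq (a : vec R I) (a0 : R) : Prop :=
  valid_ineq a a0 /\ is_facet (face_of a a0).

End Faces.

(* Ordered pairs of distinct elements; [n] is 'I_n, numbered from 0. *)
Notation arcs n := {p : 'I_n * 'I_n | p.1 != p.2}.

Definition mkarc (n : nat) (i j : 'I_n) (ij : i != j) : arcs n :=
  exist (fun p : 'I_n * 'I_n => p.1 != p.2) (i, j) ij.

Definition LO_constraints (R : realType) (n : nat) (x : vec R (arcs n))
    : Prop :=
  (forall (i j : 'I_n) (ij : i != j) (ji : j != i), (i < j)%N ->
     x (mkarc ij) + x (mkarc ji) = 1) /\
  (forall (i j k : 'I_n) (ij : i != j) (jk : j != k) (ki : k != i),
     (i < j)%N -> (i < k)%N ->
     x (mkarc ij) + x (mkarc jk) + x (mkarc ki) <= 2).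

Definition P_LO (R : realType) (n : nat) : set (vec R (arcs n)) :=
  convex_hull [set x : vec R (arcs n) | is_01 x /\ LO_constraints x].

Definition P_LODbar (R : realType) (n : nat)
    : set (vec R (arcs n + (arcs n + arcs n))%type) :=
  convex_hull [set w : vec R (arcs n + (arcs n + arcs n))%type |
    exists x y z : vec R (arcs n),
      [/\ w = x ⊕ y ⊕ z, is_01 w, LO_constraints x, LO_constraints y
        & forall p : arcs n, x p + y p - z p <= 1]].

Arguments P_LO : clear implicits.
Arguments P_LODbar : clear implicits.

(* Main.v *)
Require Import Defs.
From mathcomp Require Import all_boot all_order all_algebra.
From mathcomp Require Import classical_sets reals.
From mathcomp Require Import boolp lra ring.
From HB Require Import structures.
Import Order.TTheory GRing.Theory Num.Theory.
Local Open Scope ring_scope.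

Set Implicit Arguments.
Unset Strict Implicit.
Unset Printing Implicit Defensive.

(** The proof never computes the dimension of either polytope.  A valid
inequality of the convex hull of S defines a facet exactly when the vertices
tight for it, together with a single further vertex w, span affinely all of S.
In terms of directions at a tight vertex f: every linear subspace U that
contains g - f for each tight vertex g, and that contains w - f, contains s - f
for each s in S.  This is [facet_convex_hullP]; both directions hold because
passing from the tight vertices to the whole polytope raises the dimension by
one exactly when one missing direction is enough.

In the polytope of triples x ⊕ y ⊕ z it remains to exhibit tight vertices.
Two families provide most of them.  If x and y are linear orderings, then z = 1
satisfies every constraint.  If y is the reversal 1 - x of x, then
x_p + y_p = 1 at every arc p, so that every 0/1 vector z is allowed; hence all
z-directions are available over the fixed pair (x, 1 - x).

For (a), let f be a tight vertex of the linear ordering polytope.  The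
x-directions are inherited from the given facet, since g ⊕ f ⊕ 1 is tight for
every tight g; the y-directions come from f ⊕ y ⊕ 1, and the z-directions from
f ⊕ (1 - f) ⊕ z ([facet_x]).  Exchanging x and y gives the other inequality
([facet_swap]).

The inequalities in (b) and (c) have the common form
alpha (x_p + y_p) + gamma z_p <= a0 with gamma nonzero, for one arc p.  Such an
inequality defines a facet as soon as, for some bit b, every bit c admits a bit
t with (x_p, y_p, z_p) = (b, c, t) feasible and tight ([facet_at_arc]): fix x0
with value b at p, let y vary arbitrarily, and repair tightness by choosing
z_p.  The directions of z other than the p-th come from x0 ⊕ (1 - x0) ⊕ z, and
the p-th one is the direction to the non-tight vertex. *)

(** * Directions of affine hulls *)

Section Dimension.
Variables (R : realType) (V : vectType R).
Implicit Types (S T : set V) (U W : {vspace V}) (s v w : V) (d : nat).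

(** Keep adding elements of T outside the current span: each of them raises the
dimension, so this stops. *)
Lemma finite_spanning T :
  exists2 X : seq V, {in X, forall x, T x} & forall t, T t -> t \in <<X>>%VS.
Proof.
suff H k X : {in X, forall x, T x} -> (\dim {:V} <= \dim <<X>> + k)%N ->
    exists2 X' : seq V, {in X', forall x, T x} &
      forall t, T t -> t \in <<X'>>%VS.
  by apply: (H (\dim {:V}) [::]) => //; apply: leq_addl.
elim: k X => [|k IHk] X XT leVX.
  exists X => // t _; rewrite addn0 in leVX.
  have /eqP -> : <<X>>%VS == fullv by rewrite eqEdim subvf.
  exact: memvf.
have [XS|/existsNP[t /not_implyP[Tt /negP tX]]] :=
  pselect (forall t, T t -> t \in <<X>>%VS); first by exists X.
apply: (IHk (t :: X)) => [x|].
  by rewrite inE => /predU1P[->|/XT].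
have ltX : (\dim <<X>> < \dim <<t :: X>>)%N.
  have XtX : (<<X>> <= <<t :: X>>)%VS by rewrite span_cons addvSr.
  rewrite ltn_neqAle dimvS // andbT; apply: contraNneq tX => eqd.
  have /eqP -> : <<X>>%VS == <<t :: X>>%VS by rewrite eqEdim XtX eqd leqnn.
  by rewrite memv_span // mem_head.
by rewrite (leq_trans leVX) // addnS -addSn leq_add2r.
Qed.

(** For s in S, this U is the direction space of the affine hull of S.  It is
described by its universal property, the only form in which it is used, so that
no spanning family has to be carried around. *)
Definition is_direction S s U :=
  forall W, (U <= W)%VS <-> (forall t, S t -> t - s \in W).

Lemma exists_direction S s : exists U, is_direction S s U.
Proof.
have [X XS SX] := finite_spanning [set t - s | t in S]%classic.
exists <<X>>%VS => W; split=> [XW t St|SW].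
  by apply: (subvP XW); apply: SX; exists t.
by apply/span_subvP => x /XS [t St <-]; apply: SW.
Qed.

Lemma direction_mem S s U t : is_direction S s U -> S t -> t - s \in U.
Proof. by move=> dirU St; apply: (dirU U).1 => //; apply: subvv. Qed.

Lemma direction_unique S s U U' :
  is_direction S s U -> is_direction S s U' -> U = U'.
Proof.
move=> dirU dirU'; apply/eqP; rewrite eqEsubv; apply/andP; split.
  by apply/dirU => t; apply: direction_mem.
by apply/dirU' => t; apply: direction_mem.
Qed.

Lemma dim_addv_line U v : v \notin U -> \dim (U + <[v]>) = (\dim U).+1.
Proof.
move=> vU; have v0 : v != 0 by apply: contraNneq vU => ->; rewrite mem0v.
rewrite dimv_disjoint_sum ?dim_vline ?v0 ?addn1 //.
apply/eqP; rewrite -subv0; apply/subvP => x.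
rewrite memv_cap => /andP[xU /vlineP[c xE]]; move: xU; rewrite {}xE memv0.
have [->|c0 cvU] := eqVneq c 0; first by rewrite scale0r.
by rewrite -[v](scalerK c0) memvZ in vU.
Qed.

Lemma subset_affine_hull S s : S s -> affine_hull S s.
Proof.
move=> Ss; exists 1%N, (fun=> 1), (fun=> s); split=> //.
  by rewrite big_ord1.
by rewrite big_ord1 scale1r.
Qed.

(** Two more points, with the coefficients c and - c, leave the total weight
unchanged. *)
Lemma affine_hull_move S w s t c :
  affine_hull S w -> S s -> S t -> affine_hull S (w + c *: (t - s)).
Proof.
move=> [m [b [v [Sv b1 ->]]]] Ss St.
exists m.+2, (fun k => oapp (oapp b (- c) \o unlift ord0) c (unlift ord0 k)),
  (fun k => oapp (oapp v s \o unlift ord0) t (unlift ord0 k)).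
split=> [k||].
- by case: (unlift ord0 k) => [j|] //=; case: (unlift ord0 j) => /=.
- rewrite !big_ord_recl unlift_none liftK /= unlift_none /=.
  under eq_bigr do rewrite liftK /= liftK /=.
  by rewrite b1; ring.
rewrite !big_ord_recl unlift_none liftK /= unlift_none /=.
under [in RHS]eq_bigr do rewrite !liftK /= !liftK /=.
by rewrite scalerBr scaleNr [LHS]addrC addrA.
Qed.

Lemma affine_hull_direction S s U : S s -> is_direction S s U ->
  affine_hull S = [set w | w - s \in U]%classic.
Proof.
move=> Ss dirU; apply/seteqP; split=> w /=.
  move=> [m [c [v [Sv c1 ->]]]].
  rewrite -[s]scale1r -c1 scaler_suml -sumrB.
  by apply: memv_suml => k _; rewrite -scalerBr memvZ // (direction_mem dirU).
have [X XS SX] := finite_spanning [set t - s | t in S]%classic.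
have UX : (U <= <<X>>)%VS by apply/dirU => t St; apply: SX; exists t.
suff move_span v u : affine_hull S v -> u \in <<X>>%VS -> affine_hull S (v + u).
  move=> /(subvP UX) wsX; rewrite -[w](subrKC s).
  exact: move_span (subset_affine_hull Ss) wsX.
elim: X v u XS {UX SX} => [|x X IHX] v u XS Sv.
  by rewrite span_nil memv0 => /eqP ->; rewrite addr0.
rewrite span_cons => /memv_addP[y /vlineP[c ->] [u' u'X ->]].
rewrite addrA; apply: IHX => // [z zX|]; first by apply: XS; rewrite inE zX orbT.
have [t St <-] := XS x (mem_head _ _).
exact: affine_hull_move.
Qed.

(** The base point v in [has_dim] is arbitrary; it can be replaced by any point of
S, because that point differs from v by an element of the direction space. *)
Lemma has_dim_direction S s d : S s ->
  has_dim S d <-> exists2 U, is_direction S s U & \dim U = d.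
Proof.
move=> Ss; split=> [[v [U [affS dimU]]]|[U dirU dimU]]; last first.
  by exists s, U; split => //; apply: affine_hull_direction.
have [W dirW] := exists_direction S s.
exists W => //; rewrite -dimU; congr (\dim _).
have svU : s - v \in U.
  by have := subset_affine_hull Ss; rewrite affS.
have affE u : (s + u - v \in U) = (u \in W).
  apply/idP/idP => [suU|uW].
    have : affine_hull S (s + u) by rewrite affS.
    by rewrite (affine_hull_direction Ss dirW) /= addrC addKr.
  have : affine_hull S (s + u).
    by rewrite (affine_hull_direction Ss dirW) /= addrC addKr.
  by rewrite affS.
by apply/vspaceP => u; rewrite -affE addrAC rpredDl.
Qed.

Lemma subset_convex_hull S s : S s -> convex_hull S s.
Proof.
move=> Ss; exists 1%N, (fun=> 1), (fun=> s); split=> //.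
  by rewrite big_ord1.
by rewrite big_ord1 scale1r.
Qed.

Lemma convex_hull_direction S s U :
  is_direction S s U -> is_direction (convex_hull S) s U.
Proof.
move=> dirU W; split=> [UW w [m [c [v [_ Sv c1 ->]]]]|SW].
  rewrite -[s]scale1r -c1 scaler_suml -sumrB.
  apply: memv_suml => k _; rewrite -scalerBr memvZ //.
  by apply: (subvP UW); apply: (direction_mem dirU).
by apply/dirU => t /subset_convex_hull /SW.
Qed.

End Dimension.

(** * A criterion for facets of a convex hull *)

Section Facets.
Variables (R : realType) (I : finType).
Implicit Types (S : set (vec R I)) (a f g s w : vec R I) (c : R).

Lemma dot_is_linear a : linear_for *%R (dot a).
Proof.
move=> c u w; rewrite /dot mulr_sumr -big_split; apply: eq_bigr => i _.
by rewrite !ffunE /GRing.scale /=; ring.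
Qed.

HB.instance Definition _ a :=
  GRing.isLinear.Build R (vec R I) R *%R (dot a) (dot_is_linear a).

Lemma valid_convex_hull S a (a0 : R) :
  (forall w, S w -> dot a w <= a0) -> valid_ineq (convex_hull S) a a0.
Proof.
move=> leS w [m [c [v [c_ge0 Sv c1 ->]]]].
rewrite linear_sum -[leRHS]mul1r -c1 mulr_suml.
by apply: ler_sum => k _; rewrite linearZ ler_wpM2l // leS.
Qed.

(** The slacks c_k (a0 - a . v_k) are nonnegative and sum to zero, so each of them
vanishes. *)
Lemma tight_convex_combination S a (a0 : R) m (c : 'I_m -> R) (v : 'I_m -> vec R I) :
    (forall w, S w -> dot a w <= a0) -> (forall k, 0 <= c k) ->
    (forall k, S (v k)) -> \sum_(k < m) c k = 1 ->
    dot a (\sum_(k < m) c k *: v k) = a0 ->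
  forall k, c k = 0 \/ dot a (v k) = a0.
Proof.
move=> leS c_ge0 Sv c1 tight k.
have slack_ge0 j : 0 <= c j * (a0 - dot a (v j)).
  by rewrite mulr_ge0 // subr_ge0 leS.
have /eqP : \sum_(j < m) c j * (a0 - dot a (v j)) = 0.
  under eq_bigr do rewrite mulrBr.
  rewrite sumrB -mulr_suml c1 mul1r -[X in X - _]tight linear_sum.
  by apply/eqP; rewrite subr_eq0; apply/eqP; apply: eq_bigr => j _; rewrite linearZ.
rewrite psumr_eq0 // => /allP /(_ k (mem_index_enum k)) /=.
rewrite mulf_eq0 subr_eq0 => /orP[/eqP|/eqP]; first by left.
by right.
Qed.

Definition tight S a (a0 : R) : set (vec R I) := [set w | S w /\ dot a w = a0]%classic.

Lemma face_direction S a (a0 : R) f U : (forall w, S w -> dot a w <= a0) ->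
  is_direction (tight S a a0) f U ->
  is_direction (face_of (convex_hull S) a a0) f U.
Proof.
move=> leS dirU W; split=> [UW w [[m [c [v [c_ge0 Sv c1 ->]]]] wa0]|FW].
  have tc := tight_convex_combination leS c_ge0 Sv c1 wa0.
  rewrite -[f]scale1r -c1 scaler_suml -sumrB.
  apply: memv_suml => k _; rewrite -scalerBr.
  have [->|ta] := tc k; first by rewrite scale0r mem0v.
  by rewrite memvZ //; apply: (subvP UW); apply: (direction_mem dirU); split.
by apply/dirU => t [St ta]; apply: FW; split=> //; apply: subset_convex_hull.
Qed.

(** The functional a is constant on the tight points, hence vanishes on their
directions; a direction to a non-tight point is therefore a new one. *)
Lemma direction_dot S a (a0 : R) f U w : dot a f = a0 ->
  is_direction (tight S a a0) f U -> w - f \in U -> dot a w = a0.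
Proof.
move=> fa0 dirU wfU.
have : (U <= lker (linfun (dot a : vec R I -> R^o)))%VS.
  apply/dirU => t [_ ta0]; rewrite memv_ker lfunE /= linearB /=.
  by rewrite ta0 fa0 subrr.
move=> /subvP /(_ _ wfU); rewrite memv_ker lfunE /= linearB /= fa0.
by rewrite subr_eq0 => /eqP.
Qed.

(** From right to left, the direction space W of S is U + <[w - f]>, where U is that
of the tight points, and w - f is not in U, so that \dim W = (\dim U).+1.  From
left to right, any non-tight w will do, since then U + <[w - f]> lies in W and has
the same dimension. *)
Lemma facet_convex_hullP S a (a0 : R) :
  facet_ineq (convex_hull S) a a0 <->
  (forall w, S w -> dot a w <= a0) /\
  exists f w, [/\ tight S a a0 f, S w, dot a w <> a0 &
    forall U : {vspace vec R I}, (forall g, tight S a a0 g -> g - f \in U) ->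
      w - f \in U -> forall s, S s -> s - f \in U].
Proof.
split=> [[val [_ [d [dimP dimF]]]]|[leS [f [w [tf Sw wa0 span]]]]].
  have leS w : S w -> dot a w <= a0 by move/subset_convex_hull/val.
  split=> //.
  (* The face is nonempty because it has a dimension; one of the points combined
     into an element of the face has a nonzero weight and is then tight. *)
  have [f tf] : exists f, tight S a a0 f.
    have [v [U [affF _]]] := dimF.
    have : affine_hull (face_of (convex_hull S) a a0) v.
      by rewrite affF /= subrr mem0v.
    move=> [[|m] [c [w [Fw c1 _]]]].
      by move/eqP: c1; rewrite big_ord0 eq_sym oner_eq0.
    have [[[|k] [b [s [b_ge0 Ss b1 ->]]]] fa0] := Fw ord0.
      by move/eqP: b1; rewrite big_ord0 eq_sym oner_eq0.
    have tb := tight_convex_combination leS b_ge0 Ss b1 fa0.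
    apply: contrapT => /forallNP nt; move/eqP: b1.
    rewrite big1 ?(eq_sym 0) ?oner_eq0 // => j _.
    by have [//|sa0] := tb j; case: (nt (s j)).
  have Ff : face_of (convex_hull S) a a0 f.
    by case: tf => Sf; split=> //; apply: subset_convex_hull.
  have [U dirU] := exists_direction (tight S a a0) f.
  have [W dirW] := exists_direction S f.
  have dimU : \dim U = d.
    have [U' dirU' <-] := (has_dim_direction _ Ff).1 dimF.
    by congr (\dim _); apply: direction_unique (face_direction leS dirU) dirU'.
  have dimW : \dim W = d.+1.
    have [W' dirW' <-] := (has_dim_direction _ (proj1 Ff)).1 dimP.
    by congr (\dim _); apply: direction_unique (convex_hull_direction dirW) dirW'.
  have UW : (U <= W)%VS by apply/dirU => t [St _]; apply: direction_mem dirW St.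
  (* Otherwise the face would be the whole hull, of the same dimension. *)
  have [w [Sw wa0]] : exists w, S w /\ dot a w <> a0.
    apply: contrapT => /forallNP all_tight.
    have : (W <= U)%VS.
      apply/dirW => t St; apply: (direction_mem dirU); split=> //.
      by apply: contrapT => ta; apply: (all_tight t).
    by move/dimvS; rewrite dimU dimW ltnn.
  exists f, w; split=> // V tV wV s Ss.
  suff : (W <= V)%VS by move/subvP; apply; apply: direction_mem dirW Ss.
  have UwW : (U + <[w - f]> <= W)%VS.
    by rewrite subv_add UW -memvE (direction_mem dirW).
  have wU : w - f \notin U.
    by apply/negP => /(direction_dot (proj2 tf) dirU).
  have /eqP <- : (U + <[w - f]>)%VS == W.
    by rewrite eqEdim UwW dim_addv_line // dimU dimW leqnn.
  by rewrite subv_add -memvE wV andbT; apply/dirU.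
have [U dirU] := exists_direction (tight S a a0) f.
have Sf : S f by case: tf.
have Ff : face_of (convex_hull S) a a0 f.
  by case: tf => ? ?; split=> //; apply: subset_convex_hull.
have dirUw : is_direction S f (U + <[w - f]>).
  move=> W; rewrite subv_add -memvE; split=> [/andP[UW wW]|SW].
    by apply: span => // g tg; apply: (subvP UW); apply: direction_mem dirU tg.
  by rewrite SW // andbT; apply/dirU => g [Sg _]; apply: SW.
have val := valid_convex_hull leS.
split=> //; split; first by exists a, a0.
exists (\dim U); split.
  apply/has_dim_direction; first exact: subset_convex_hull Sf.
  exists (U + <[w - f]>)%VS; first exact: convex_hull_direction.
  by apply: dim_addv_line; apply/negP => /(direction_dot (proj2 tf) dirU).
apply/(has_dim_direction _ Ff); exists U => //; exact: face_direction.
Qed.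

End Facets.

(** A subspace U for the criterion on S' is pulled back along h to one for S. *)
Lemma facet_linear_image (R : realType) (I J : finType) (S : set (vec R I))
    (S' : set (vec R J)) (h : {linear vec R I -> vec R J}) a a' (a0 : R) :
    (forall w, S w -> S' (h w)) ->
    (forall w', S' w' -> exists2 w, S w & w' = h w) ->
    (forall w, dot a' (h w) = dot a w) ->
  facet_ineq (convex_hull S) a a0 -> facet_ineq (convex_hull S') a' a0.
Proof.
move=> hS hS' dotE /facet_convex_hullP[leS [f [w [[Sf fa0] Sw wa0 span]]]].
apply/facet_convex_hullP; split=> [_ /hS'[v Sv ->]|]; first by rewrite dotE leS.
exists (h f), (h w); split; rewrite ?dotE //; first by split; rewrite ?dotE; auto.
  exact: hS.
move=> U tightU wU _ /hS'[v Sv ->]; rewrite -linearB.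
have preimE u : (u \in linfun h @^-1: U)%VS = (h u \in U).
  by rewrite -memv_preim lfunE.
rewrite -preimE; apply: span => //; rewrite ?preimE ?linearB // => g [Sg ga0].
by rewrite preimE linearB; apply: tightU; split; [apply: hS|rewrite dotE].
Qed.

(** * Linear orderings and their triples *)

Section LinearOrderings.
Variables (R : realType) (n : nat).
Implicit Types (x y z : vec R (arcs n)) (p q : arcs n) (b c t : R).

Definition bit t : Prop := t = 0 \/ t = 1.

(** [P_LO] and [P_LODbar] are by definition the convex hulls of the next two sets. *)
Definition lo_vertex : set (vec R (arcs n)) :=
  [set x | is_01 x /\ LO_constraints x]%classic.

Definition lod_vertex : set (vec R (arcs n + (arcs n + arcs n))%type) :=
  [set w | exists x y z : vec R (arcs n),
      [/\ w = x ⊕ y ⊕ z, is_01 w, LO_constraints x, LO_constraints y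
        & forall p : arcs n, x p + y p - z p <= 1]]%classic.

Lemma lod_vertexP x y z :
  lod_vertex (x ⊕ y ⊕ z) <->
  [/\ lo_vertex x, lo_vertex y, is_01 z & forall p, x p + y p - z p <= 1].
Proof.
split=> [[x' [y' [z' [E w01 xLO yLO xyz]]]]|[[x01 xLO] [y01 yLO] z01 xyz]].
  have Ex : x' = x.
    apply/ffunP => p; have := congr1 (fun w : vec R _ => w (inl p)) E.
    by rewrite /= !ffunE.
  have Ey : y' = y.
    apply/ffunP => p; have := congr1 (fun w : vec R _ => w (inr (inl p))) E.
    by rewrite /= !ffunE.
  have Ez : z' = z.
    apply/ffunP => p; have := congr1 (fun w : vec R _ => w (inr (inr p))) E.
    by rewrite /= !ffunE.
  subst x' y' z'; split=> //.
  - by split=> // p; have := w01 (inl p); rewrite ffunE.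
  - by split=> // p; have := w01 (inr (inl p)); rewrite !ffunE.
  by move=> p; have := w01 (inr (inr p)); rewrite !ffunE.
exists x, y, z; split=> // -[p|[p|p]]; rewrite !ffunE; first exact: x01.
  exact: y01.
exact: z01.
Qed.

Lemma lod_vertexE w : lod_vertex w -> exists x y z, w = x ⊕ y ⊕ z.
Proof. by move=> [x [y [z [-> _ _ _ _]]]]; exists x, y, z. Qed.

(** On a linear ordering, 1 - x_ij = x_ji: this is the opposite ordering. *)
Definition rev x : vec R (arcs n) := [ffun p => 1 - x p].

(** The cyclic inequality for (i, j, k) in the opposite ordering is the one for
(i, k, j) in the given one. *)
Lemma lo_vertex_rev x : lo_vertex x -> lo_vertex (rev x).
Proof.
move=> [x01 [xopp xcyc]]; split=> [p|].
  by rewrite ffunE; have [->|->] := x01 p; [right|left]; rewrite ?subr0 ?subrr.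
have opp (i j : 'I_n) (ij : i != j) (ji : j != i) : x (mkarc ij) + x (mkarc ji) = 1.
  have [lt_ij|lt_ji|/val_inj eq_ij] := ltngtP i j; first exact: xopp.
    by rewrite addrC; apply: xopp.
  by case/negP: ij; rewrite eq_ij.
split=> [i j ij ji _|i j k ij jk ki lt_ij lt_ik]; rewrite !ffunE.
  by have := opp i j ij ji; lra.
have ji : j != i by rewrite eq_sym.
have kj : k != j by rewrite eq_sym.
have ik : i != k by rewrite eq_sym.
have := xcyc i k j ik kj ji lt_ik lt_ij.
by have := opp _ _ ij ji; have := opp _ _ jk kj; have := opp _ _ ki ik; lra.
Qed.

(** Either the natural ordering of the indices or its opposite has value b at p. *)
Lemma lo_vertex_at p b : bit b -> exists2 x, lo_vertex x & x p = b.
Proof.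
pose ord : vec R (arcs n) := [ffun q : arcs n => ((val q).1 < (val q).2)%N%:R].
have ordLO : lo_vertex ord.
  split=> [q|]; first by rewrite ffunE; case: (_ < _)%N; [right|left].
  split=> [i j ij ji lt_ij|i j k ij jk ki lt_ij lt_ik]; rewrite !ffunE /=.
    by rewrite lt_ij ltnNge (ltnW lt_ij) addr0.
  rewrite lt_ij [(k < i)%N]ltnNge (ltnW lt_ik) addr0.
  by case: (j < k)%N; rewrite /=; lra.
move=> b01; have [/eqP <-|ordp] := boolP (ord p == b); first by exists ord.
exists (rev ord); first exact: lo_vertex_rev.
move: ordp; rewrite !ffunE; case: (_ < _)%N; case: b01 => ->;
  rewrite ?eqxx //= => _; lra.
Qed.

Lemma lod_vertex_one x y :
  lo_vertex x -> lo_vertex y -> lod_vertex (x ⊕ y ⊕ [ffun=> 1]).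
Proof.
move=> xLO yLO; apply/lod_vertexP; split=> // p; rewrite ffunE; first by right.
by have [[x01 _] [y01 _]] := (xLO, yLO); case: (x01 p) => ->; case: (y01 p) => ->; lra.
Qed.

Lemma lod_vertex_rev x z :
  lo_vertex x -> is_01 z -> lod_vertex (x ⊕ rev x ⊕ z).
Proof.
move=> xLO z01; apply/lod_vertexP; split=> //; first exact: lo_vertex_rev.
by move=> p; rewrite ffunE; case: (z01 p) => ->; lra.
Qed.

Lemma oplusB (I J : finType) (x x' : vec R I) (y y' : vec R J) :
  (x ⊕ y) - (x' ⊕ y') = (x - x') ⊕ (y - y').
Proof. by apply/ffunP => -[k|k]; rewrite !ffunE. Qed.

Lemma oplus_linear (I J : finType) c (x x' : vec R I) (y y' : vec R J) :
  c *: (x ⊕ y) + (x' ⊕ y') = (c *: x + x') ⊕ (c *: y + y').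
Proof. by apply/ffunP => -[k|k]; rewrite !ffunE. Qed.

Lemma dot_oplus (I J : finType) (a x : vec R I) (b y : vec R J) :
  dot (a ⊕ b) (x ⊕ y) = dot a x + dot b y.
Proof.
by rewrite /dot big_sumType /=; congr (_ + _); apply: eq_bigr => k _; rewrite !ffunE.
Qed.

Lemma dot0l (I : finType) (x : vec R I) : dot 0 x = 0.
Proof. by rewrite /dot big1 // => k _; rewrite ffunE mul0r. Qed.

Lemma scale_unit_vecE c p q : (c *: unit_vec R p) q = c * (q == p)%:R.
Proof. by rewrite !ffunE. Qed.

Lemma dot_unit_vec c p x : dot (c *: unit_vec R p) x = c * x p.
Proof.
rewrite /dot (bigD1 p) //= big1 ?addr0; last first.
  by move=> q /negPf qp; rewrite scale_unit_vecE qp mulr0 mul0r.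
by rewrite scale_unit_vecE eqxx mulr1.
Qed.

Definition in_x x : vec R (arcs n + (arcs n + arcs n))%type := x ⊕ 0 ⊕ 0.
Definition in_y y : vec R (arcs n + (arcs n + arcs n))%type := 0 ⊕ y ⊕ 0.
Definition in_z z : vec R (arcs n + (arcs n + arcs n))%type := 0 ⊕ 0 ⊕ z.

Lemma in_x_is_linear : linear in_x.
Proof. by move=> c x x'; rewrite /in_x !oplus_linear !scaler0 !addr0. Qed.
Lemma in_y_is_linear : linear in_y.
Proof. by move=> c x x'; rewrite /in_y !oplus_linear !scaler0 !addr0. Qed.
Lemma in_z_is_linear : linear in_z.
Proof. by move=> c x x'; rewrite /in_z !oplus_linear !scaler0 !addr0. Qed.

HB.instance Definition _ := GRing.isLinear.Build R _ _ _ in_x in_x_is_linear.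
HB.instance Definition _ := GRing.isLinear.Build R _ _ _ in_y in_y_is_linear.
HB.instance Definition _ := GRing.isLinear.Build R _ _ _ in_z in_z_is_linear.

Lemma oplusE x y z : x ⊕ y ⊕ z = in_x x + in_y y + in_z z.
Proof. by apply/ffunP => -[k|[k|k]]; rewrite !ffunE ?addr0 ?add0r. Qed.

Lemma oplus3B x y z x' y' z' :
  (x ⊕ y ⊕ z) - (x' ⊕ y' ⊕ z') = in_x (x - x') + in_y (y - y') + in_z (z - z').
Proof. by rewrite !oplusB oplusE. Qed.

(** * Facets of the polytope of triples *)

(** For a tight f and a non-tight w of the given facet, f ⊕ f ⊕ 1 and w ⊕ f ⊕ 1
differ in x only, so the criterion for a applies to the preimage of U under
[in_x]. *)
Lemma facet_x a (a0 : R) :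
  facet_ineq (P_LO R n) a a0 -> facet_ineq (P_LODbar R n) (a ⊕ 0 ⊕ 0) a0.
Proof.
have dotE x y z : dot (a ⊕ 0 ⊕ 0) (x ⊕ y ⊕ z) = dot a x.
  by rewrite !dot_oplus !dot0l !addr0.
move=> /facet_convex_hullP[leS [f [w [[fLO fa0] wLO wa0 span]]]].
apply/facet_convex_hullP; split=> [v vLOD|].
  have [x [y [z vE]]] := lod_vertexE vLOD.
  by move: vLOD; rewrite vE => /lod_vertexP[xLO _ _ _]; rewrite dotE leS.
exists (f ⊕ f ⊕ [ffun=> 1]), (w ⊕ f ⊕ [ffun=> 1]); split.
- by split; [apply: lod_vertex_one|rewrite dotE].
- exact: lod_vertex_one.
- by rewrite dotE.
move=> U tightU; rewrite oplus3B !subrr !linear0 !addr0 => wU s sLOD.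
have [x [y [z sE]]] := lod_vertexE sLOD.
move: sLOD; rewrite sE => /lod_vertexP[xLO yLO z01 _].
rewrite oplus3B !rpredD //.
- suff : x - f \in (linfun in_x @^-1: U)%VS by rewrite -memv_preim lfunE.
  apply: span => //; rewrite -?memv_preim ?lfunE // => g [gLO ga0].
  rewrite -memv_preim lfunE /=.
  have /tightU : tight lod_vertex (a ⊕ 0 ⊕ 0) a0 (g ⊕ f ⊕ [ffun=> 1]).
    by split; [apply: lod_vertex_one|rewrite dotE].
  by rewrite oplus3B !subrr !linear0 !addr0.
- have /tightU : tight lod_vertex (a ⊕ 0 ⊕ 0) a0 (f ⊕ y ⊕ [ffun=> 1]).
    by split; [apply: lod_vertex_one|rewrite dotE].
  by rewrite oplus3B !subrr !linear0 add0r addr0.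
(* The base point has y = f rather than rev f, hence a difference of two tight
   vertices for the z-directions. *)
have /tightU U1 : tight lod_vertex (a ⊕ 0 ⊕ 0) a0 (f ⊕ rev f ⊕ z).
  by split; [apply: lod_vertex_rev|rewrite dotE].
have /tightU U2 : tight lod_vertex (a ⊕ 0 ⊕ 0) a0 (f ⊕ rev f ⊕ [ffun=> 1]).
  by split; [apply: lod_vertex_one => //; apply: lo_vertex_rev|rewrite dotE].
have := rpredB U1 U2.
by rewrite opprB addrA subrK oplus3B !subrr !linear0 !add0r.
Qed.

Definition swap (w : vec R (arcs n + (arcs n + arcs n))%type)
    : vec R (arcs n + (arcs n + arcs n))%type :=
  [ffun k => w match k with
               | inl p => inr (inl p)
               | inr (inl p) => inl p
               | inr (inr p) => inr (inr p)
               end].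

Lemma swap_is_linear : linear swap.
Proof. by move=> c u v; apply/ffunP => k; rewrite !ffunE. Qed.

HB.instance Definition _ := GRing.isLinear.Build R _ _ _ swap swap_is_linear.

Lemma swap_oplus x y z : swap (x ⊕ y ⊕ z) = y ⊕ x ⊕ z.
Proof. by apply/ffunP => -[p|[p|p]]; rewrite !ffunE. Qed.

Lemma lod_vertex_swap w : lod_vertex w -> lod_vertex (swap w).
Proof.
move=> wLOD; have [x [y [z wE]]] := lod_vertexE wLOD; move: wLOD.
rewrite wE swap_oplus => /lod_vertexP[xLO yLO z01 xyz]; apply/lod_vertexP; split=> //.
by move=> p; rewrite [y p + _]addrC.
Qed.

Lemma swapK : involutive swap.
Proof. by move=> w; apply/ffunP => -[p|[p|p]]; rewrite !ffunE. Qed.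

Lemma dot_swap a w : dot (swap a) (swap w) = dot a w.
Proof.
rewrite /dot !big_sumType /= [LHS]addrCA.
by congr (_ + (_ + _)); apply: eq_bigr => p _; rewrite !ffunE.
Qed.

Lemma facet_swap a (a0 : R) :
  facet_ineq (P_LODbar R n) a a0 -> facet_ineq (P_LODbar R n) (swap a) a0.
Proof.
apply: (facet_linear_image (h := swap)) => [w|w wLOD|w].
- exact: lod_vertex_swap.
- by exists (swap w); [apply: lod_vertex_swap|rewrite /= swapK].
exact: dot_swap.
Qed.

(** Away from p, the value 1 makes the constraints on z harmless. *)
Definition one_but p t : vec R (arcs n) := [ffun q => if q == p then t else 1].

Lemma one_but01 p t : bit t -> is_01 (one_but p t).
Proof. by move=> t01 q; rewrite ffunE; case: (q == p) => //; right. Qed.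

Lemma one_butB p t t' : one_but p t - one_but p t' = (t - t') *: unit_vec R p.
Proof.
apply/ffunP => q; rewrite [RHS]scale_unit_vecE !ffunE.
by case: (q == p); [rewrite mulr1|rewrite mulr0 subrr].
Qed.

Lemma lod_vertex_one_but p t x y : bit t -> lo_vertex x -> lo_vertex y ->
  x p + y p - t <= 1 -> lod_vertex (x ⊕ y ⊕ one_but p t).
Proof.
move=> t01 xLO yLO xyt; apply/lod_vertexP; split=> //; first exact: one_but01.
move=> q; rewrite ffunE; have [->//|_] := eqVneq q p.
by have [[x01 _] [y01 _]] := (xLO, yLO); case: (x01 q) => ->; case: (y01 q) => ->; lra.
Qed.

(** The inequality is symmetric in x and y, so the hypothesis on b, used with x_p = b
to obtain the y-directions, also gives the x-directions with y_p = b.  Taking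
c = 1 - b yields the tight vertex x0 ⊕ rev x0 ⊕ one_but p t0 that serves as base
point; flipping t0 keeps it feasible, since x_p + y_p = 1, and makes it non-tight,
since gamma is nonzero. *)
Lemma facet_at_arc p (alpha gamma a0 : R) b : gamma != 0 ->
    (forall r s t, bit r -> bit s -> bit t -> r + s - t <= 1 ->
       alpha * (r + s) + gamma * t <= a0) ->
    bit b ->
    (forall c, bit c -> exists t,
       [/\ bit t, b + c - t <= 1 & alpha * (b + c) + gamma * t = a0]) ->
  facet_ineq (P_LODbar R n)
    (alpha *: unit_vec R p ⊕ alpha *: unit_vec R p ⊕ gamma *: unit_vec R p) a0.
Proof.
move=> gamma0 leS b01 tight_at.
set a := _ ⊕ _.
have dotE x y z : dot a (x ⊕ y ⊕ z) = alpha * (x p + y p) + gamma * z p.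
  by rewrite !dot_oplus !dot_unit_vec mulrDr addrA.
have [x0 x0LO x0p] := lo_vertex_at p b01.
have x0rLO := lo_vertex_rev x0LO.
have rev01 : bit (1 - b) by case: b01 => ->; [right|left]; lra.
have [t0 [t01 _ t0a]] := tight_at _ rev01.
have tight0 z : is_01 z -> z p = t0 -> tight lod_vertex a a0 (x0 ⊕ rev x0 ⊕ z).
  move=> z01 zp; split; first exact: lod_vertex_rev.
  by rewrite dotE ffunE x0p zp.
have one_butp t : one_but p t p = t by rewrite ffunE eqxx.
have t01' : bit (1 - t0) by case: t01 => ->; [right|left]; lra.
apply/facet_convex_hullP; split=> [w wLOD|].
  have [x [y [z wE]]] := lod_vertexE wLOD.
  move: wLOD; rewrite wE => /lod_vertexP[[x01 _] [y01 _] z01 xyz].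
  by rewrite dotE; apply: leS.
exists (x0 ⊕ rev x0 ⊕ one_but p t0), (x0 ⊕ rev x0 ⊕ one_but p (1 - t0)); split.
- by apply: tight0 => //; apply: one_but01.
- by apply: lod_vertex_rev => //; apply: one_but01.
- rewrite dotE one_butp ffunE x0p => eq_a0.
  have : gamma * (1 - t0 *+ 2) = 0 by rewrite -mulr_natr; lra.
  move/eqP; rewrite mulf_eq0 (negPf gamma0) /=.
  by case: t01 => ->; lra.
move=> U tightU; rewrite oplus3B !subrr !linear0 !add0r one_butB => tU.
have tightUB g h : tight lod_vertex a a0 g -> tight lod_vertex a a0 h -> g - h \in U.
  by move=> /tightU gU /tightU /(rpredB gU); rewrite opprB addrA subrK.
have pU : in_z (unit_vec R p) \in U.
  have t2 : 1 - t0 - t0 != 0.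
    by case: t01 => ->; rewrite ?subr0 ?subrr ?sub0r ?oppr_eq0 oner_neq0.
  by move: tU; rewrite linearZ_LR rpredZeq (negPf t2).
(* For q different from p, changing z_q keeps x0 ⊕ rev x0 ⊕ z tight. *)
have qU q : in_z (unit_vec R q) \in U.
  have [->//|qp] := eqVneq q p.
  pose z0 : vec R (arcs n) := one_but p t0 - unit_vec R q.
  have z0p : z0 p = t0 by rewrite !ffunE eqxx eq_sym (negPf qp) subr0.
  have z001 : is_01 z0.
    move=> r; rewrite !ffunE; have [->|_] := eqVneq r p.
      by rewrite eq_sym (negPf qp) subr0.
    by case: (r == q); [left; rewrite subrr|right; rewrite subr0].
  have := tightUB _ _ (tight0 _ (one_but01 p t01) (one_butp t0)) (tight0 _ z001 z0p).
  by rewrite oplus3B !subrr !linear0 !add0r /z0 opprB addrC subrK.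
have zU z : in_z z \in U.
  have -> : z = \sum_q z q *: unit_vec R q.
    apply/ffunP => r; rewrite sum_ffunE (bigD1 r) //= big1 ?addr0.
      by rewrite scale_unit_vecE eqxx mulr1.
    by move=> q qr; rewrite scale_unit_vecE eq_sym (negPf qr) mulr0.
  rewrite (linear_sum in_z); apply: memv_suml => q _.
  by rewrite linearZ_LR memvZ ?qU.
(* The entry z_p is chosen to restore tightness; the resulting z-component of the
   difference is in U already. *)
have xU x : lo_vertex x ->
    exists t, tight lod_vertex a a0 (x ⊕ x0 ⊕ one_but p t).
  move=> xLO; have [t [tbit bct ta]] := tight_at _ (xLO.1 p).
  exists t; split.
    by apply: lod_vertex_one_but; rewrite ?x0p 1?[x p + b]addrC.
  by rewrite dotE one_butp x0p [x p + b]addrC.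
have yU y : lo_vertex y ->
    exists t, tight lod_vertex a a0 (x0 ⊕ y ⊕ one_but p t).
  move=> yLO; have [t [tbit bct ta]] := tight_at _ (yLO.1 p).
  exists t; split; first by apply: lod_vertex_one_but; rewrite ?x0p.
  by rewrite dotE one_butp x0p.
move=> s sLOD; have [x [y [z sE]]] := lod_vertexE sLOD.
move: sLOD; rewrite sE => /lod_vertexP[xLO yLO _ _].
rewrite oplus3B; apply: rpredD; last exact: zU.
apply: rpredD.
  have [t tx] := xU _ xLO; have [t' tx'] := xU _ x0LO.
  have := tightUB _ _ tx tx'.
  by rewrite oplus3B subrr linear0 addr0 rpredDr ?zU.
have [t ty] := yU _ yLO; have [t' ty'] := yU _ x0rLO.
have := tightUB _ _ ty ty'.
by rewrite oplus3B subrr linear0 add0r rpredDr ?zU.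
Qed.

End LinearOrderings.

Theorem proposition3p4 (R : realType) (n : nat) (hn : (2 <= n)%N) :
  (forall (a : vec R (arcs n)) (a0 : R), facet_ineq (P_LO R n) a a0 ->
     facet_ineq (P_LODbar R n) (a ⊕ 0 ⊕ 0) a0 /\
     facet_ineq (P_LODbar R n) (0 ⊕ a ⊕ 0) a0) /\
  (forall (i j : 'I_n) (ij : i != j),
     facet_ineq (P_LODbar R n) (0 ⊕ 0 ⊕ - unit_vec R (mkarc ij)) 0 /\
     facet_ineq (P_LODbar R n) (0 ⊕ 0 ⊕ unit_vec R (mkarc ij)) 1) /\
  (forall (i j : 'I_n) (ij : i != j),
     facet_ineq (P_LODbar R n)
       (unit_vec R (mkarc ij) ⊕ unit_vec R (mkarc ij) ⊕ - unit_vec R (mkarc ij)) 1).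
Proof.
split=> [a a0 fa|].
  have fx := facet_x fa; split=> //.
  by rewrite -[_ ⊕ _]swap_oplus; apply: facet_swap.
split=> i j ij; first split.
- have := @facet_at_arc R n (mkarc ij) 0 (-1) 0 0.
  rewrite scale0r scaleN1r; apply.
  + by rewrite oppr_eq0 oner_eq0.
  + by move=> r s t _ _ [->|->] _; lra.
  + by left.
  by move=> c [->|->]; exists 0; split; (left + lra).
- have := @facet_at_arc R n (mkarc ij) 0 1 1 0.
  rewrite scale0r scale1r; apply.
  + exact: oner_neq0.
  + by move=> r s t _ _ [->|->] _; lra.
  + by left.
  by move=> c [->|->]; exists 1; split; (right + lra).
have := @facet_at_arc R n (mkarc ij) 1 (-1) 1 1.
rewrite scale1r scaleN1r; apply.
- by rewrite oppr_eq0 oner_eq0.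
- by move=> r s t _ _ _; lra.
- by right.
by move=> c c01; exists c; split => //; lra.
Qed.
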